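(* With the setting below, let $k:\mathbb R^d\times\mathbb R^c\times\mathbb R^c\to\operatorname{Hom}(\mathbb R^c,\mathbb R^{c'})$ satisfy the steerability constraint $k(hy,\rho(h)u,\rho(h)v)=\sigma(h)k(y,u,v)\rho(h)^{-1}$ for all $h\in H$, $y\in\mathbb R^d$, $u,v\in\mathbb R^c$, and let $[\Psi_kf](x)=\int_{\mathbb R^d}k(x'-x,f(x),f(x'))f(x')\,\mathrm{d}x'$ for $f:\mathbb R^d\to\mathbb R^c$. Define $\kappa:G\times\mathbb R^c\times\mathbb R^c\to\operatorname{Hom}(\mathbb R^c,\mathbb R^{c'})$ by $\kappa(g,u,v)=k(\pi(g),u,\rho(\mathrm h(g))v)\rho(\mathrm h(g))$ and $\hat\omega(g^{-1}F,g'):=\kappa\big(g',[g^{-1}F](e),[g^{-1}F](g')\big)[g^{-1}F](g')$. Then for all $F\in\mathcal I_\rho$ and $g\in G$, $$\int_G\hat\omega(g^{-1}F,g')\,\mathrm{d}g'=[(\Lambda^\uparrow\circ\Psi_k\circ\Lambda^\downarrow)F](g),$$ i.e. the lifted implicit steerable convolution is an operator of the form $F\mapsto\int_G\hat\omega(g^{-1}F,g')\,\mathrm{d}g'$.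
   Context: $G=\mathbb R^d\rtimes H$ with $H\le O(d)$ closed, elements $(x,h)$, product $(x,h)(x',h')=(x+hx',hh')$, Haar measure $\mathrm{d}x\,\mathrm{d}h$ with Lebesgue $\mathrm{d}x$ and normalised Haar measure $\mathrm{d}h$ on $H$; $\pi(x,h)=x$, $\mathrm h(x,h)=h$, $s(x)=(x,e)$. $(\rho,\mathbb R^c)$, $(\sigma,\mathbb R^{c'})$ are representations of $H$; the feature vectors in $\mathbb R^c$ contain both node features and regular features. $\mathcal I_\rho$ is the induced representation: functions $F:G\to\mathbb R^c$ with $F(gh)=\rho(h^{-1})F(g)$, with action $(kF)(g)=F(k^{-1}g)$, so $[g^{-1}F](g')=F(gg')$. The lift and sink maps are $[\Lambda^\uparrow f](g)=\sigma(\mathrm h(g)^{-1})f(\pi(g))$ for $\mathbb R^{c'}$-valued $f$ and $[\Lambda^\downarrow F](x)=F(s(x))$. Integrals are assumed to exist. *)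

(* Defs.v *)
From HB Require Import structures.
From mathcomp Require Import all_boot all_order all_algebra.
From mathcomp Require Import all_classical all_reals all_analysis.
Set Implicit Arguments. Unset Strict Implicit. Unset Printing Implicit Defensive.
Import Order.TTheory GRing.Theory Num.Theory.
Import numFieldNormedType.Exports.
Local Open Scope classical_set_scope.
Local Open Scope ring_scope.

Definition Rd (R : realType) (d : nat) := g_sigma_algebraType (@open 'cV[R]_d).
Definition Md (R : realType) (d : nat) := g_sigma_algebraType (@open 'M[R]_d).

Section defs.
Variables (R : realType).

(* lam is Lebesgue measure on R^d: the (unique) Borel measure giving each
   closed box its volume. *)
Definition lebesgue_box (d : nat) (lam : set (Rd R d) -> \bar R) : Prop :=
  forall a b : 'cV[R]_d, (forall i, a i 0 <= b i 0) ->
    lam [set x : Rd R d | forall i, a i 0 <= x i 0 <= b i 0] =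
      (\prod_(i < d) (b i 0 - a i 0))%:E.

Definition closed_subgroup_Od (d : nat) (H : set 'M[R]_d) : Prop :=
  [/\ closed H, H 1%:M,
      (forall a b, H a -> H b -> H (a *m b)),
      (forall a, H a -> H (invmx a)) &
      (forall a, H a -> a *m a^T = 1%:M)].

Definition normalized_haar (d : nat) (H : set 'M[R]_d)
    (mu : set (Md R d) -> \bar R) : Prop :=
  [/\ mu setT = 1%E, mu (~` H) = 0%E &
      forall h, H h -> forall A : set (Md R d), measurable A ->
        mu ((fun a : 'M[R]_d => h *m a) @^-1` A) = mu A].

Definition representation (d n : nat) (H : set 'M[R]_d)
    (rho : 'M[R]_d -> 'M[R]_n) : Prop :=
  rho 1%:M = 1%:M /\ forall a b, H a -> H b -> rho (a *m b) = rho a *m rho b.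

(* The group G = R^d x| H : elements (x, h), product (x,h)(x',h') = (x+hx', hh'). *)
Definition gmul (d : nat) (g g' : 'cV[R]_d * 'M[R]_d) : 'cV[R]_d * 'M[R]_d :=
  (g.1 + g.2 *m g'.1, g.2 *m g'.2).
Definition gunit (d : nat) : 'cV[R]_d * 'M[R]_d := (0, 1%:M).
Definition Gset (d : nat) (H : set 'M[R]_d) : set ('cV[R]_d * 'M[R]_d) :=
  [set g | H g.2].
Definition piG (d : nat) (g : 'cV[R]_d * 'M[R]_d) := g.1.
Definition hG (d : nat) (g : 'cV[R]_d * 'M[R]_d) := g.2.
Definition sG (d : nat) (x : 'cV[R]_d) : 'cV[R]_d * 'M[R]_d := (x, 1%:M).

Definition induced_rep (d c : nat) (H : set 'M[R]_d) (rho : 'M[R]_d -> 'M[R]_c)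
    (F : 'cV[R]_d * 'M[R]_d -> 'cV[R]_c) : Prop :=
  forall g h, H g.2 -> H h -> F (gmul g (0, h)) = rho (invmx h) *m F g.

(* [g^-1 F](g') = F(g g') *)
Definition ltrans (d c : nat) (g : 'cV[R]_d * 'M[R]_d)
    (F : 'cV[R]_d * 'M[R]_d -> 'cV[R]_c) : 'cV[R]_d * 'M[R]_d -> 'cV[R]_c :=
  fun g' => F (gmul g g').

Definition kappa (d c c' : nat) (rho : 'M[R]_d -> 'M[R]_c)
    (k : 'cV[R]_d -> 'cV[R]_c -> 'cV[R]_c -> 'M[R]_(c', c))
    (g : 'cV[R]_d * 'M[R]_d) (u v : 'cV[R]_c) : 'M[R]_(c', c) :=
  k (piG g) u (rho (hG g) *m v) *m rho (hG g).

Definition omega_hat (d c c' : nat) (rho : 'M[R]_d -> 'M[R]_c)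
    (k : 'cV[R]_d -> 'cV[R]_c -> 'cV[R]_c -> 'M[R]_(c', c))
    (F' : 'cV[R]_d * 'M[R]_d -> 'cV[R]_c) (g' : 'cV[R]_d * 'M[R]_d) : 'cV[R]_c' :=
  kappa rho k g' (F' (gunit d)) (F' g') *m F' g'.

Definition vint {dT} (T : measurableType dT) (n : nat) (mu : {measure set T -> \bar R})
    (D : set T) (v : T -> 'cV[R]_n) : 'cV[R]_n :=
  \col_i Rintegral mu D (fun t => v t i 0).
Definition vintegrable {dT} (T : measurableType dT) (n : nat)
    (mu : set T -> \bar R) (D : set T) (v : T -> 'cV[R]_n) : Prop :=
  forall i, mu.-integrable D (fun t => (v t i 0)%:E).

Definition lift_up (d c' : nat) (sigma : 'M[R]_d -> 'M[R]_c')
    (f : 'cV[R]_d -> 'cV[R]_c') : 'cV[R]_d * 'M[R]_d -> 'cV[R]_c' :=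
  fun g => sigma (invmx (hG g)) *m f (piG g).
Definition sink_down (d c : nat) (F : 'cV[R]_d * 'M[R]_d -> 'cV[R]_c) :
    'cV[R]_d -> 'cV[R]_c := fun x => F (sG x).

Definition psi_integrand (d c c' : nat)
    (k : 'cV[R]_d -> 'cV[R]_c -> 'cV[R]_c -> 'M[R]_(c', c))
    (f : 'cV[R]_d -> 'cV[R]_c) (x : 'cV[R]_d) : Rd R d -> 'cV[R]_c' :=
  fun x' : 'cV[R]_d => k (x' - x) (f x) (f x') *m f x'.
Definition Psi (d c c' : nat) (lam : {measure set (Rd R d) -> \bar R})
    (k : 'cV[R]_d -> 'cV[R]_c -> 'cV[R]_c -> 'M[R]_(c', c))
    (f : 'cV[R]_d -> 'cV[R]_c) : 'cV[R]_d -> 'cV[R]_c' :=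
  fun x => vint lam setT (psi_integrand k f x).

End defs.

(* Main.v *)
(* By equivariance of [F] and steerability of [k], for [g = (x, a)] the integrand
   at [g' = (y, h)] equals [sigma(a^-1) P(x + a y)], where [P] is the integrand of
   [Psi_k] at [x]; it does not depend on [h].  As [h] ranges over a probability
   space, only the invariance of Lebesgue measure under [y |-> x + a y] is left.
   Translations: a measure is determined by its values on closed boxes.
   Rotations: for translation-invariant sigma-finite measures [nu] and [lam],
   Tonelli gives [nu A * lam B = nu (-B) * lam A]; take [nu] the pushforward of
   [lam] by the rotation and [B] the unit ball. *)
Require Import Defs.
From HB Require Import structures.
From mathcomp Require Import all_boot all_order all_algebra.
From mathcomp Require Import all_classical all_reals all_analysis.
From mathcomp Require Import measurable_realfun.
Set Implicit Arguments. Unset Strict Implicit. Unset Printing Implicit Defensive.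
Import Order.TTheory GRing.Theory Num.Theory.
Import numFieldNormedType.Exports.
Local Open Scope classical_set_scope.
Local Open Scope ring_scope.

(** * Closed boxes generate the Borel sets and determine Lebesgue measure *)

Section cbox.
Variables (R : realType) (d : nat).
Implicit Types (a b x : 'cV[R]_d) (U : set 'cV[R]_d).

Definition cbox a b : set (Rd R d) :=
  [set x : Rd R d | forall i, a i 0 <= x i 0 <= b i 0].

Definition rat_cbox (p : 'cV[rat]_d * 'cV[rat]_d) : set (Rd R d) :=
  cbox (map_mx ratr p.1) (map_mx ratr p.2).

(** Every neighbourhood of a vector contains a product of coordinate neighbourhoods, so rational
    endpoints can be chosen in each coordinate separately. Rational endpoints make the family of
    boxes countable, which keeps the union inside the sigma-algebra generated by boxes. *)
Lemma open_bigcup_rat_cbox U : open U ->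
  U = \bigcup_(p in [set p | rat_cbox p `<=` U]) rat_cbox p.
Proof.
move=> oU; apply/seteqP; split => [x Ux|x [p pU px]]; last exact: pU.
have [P /= Px PU] : nbhs x U by apply: open_nbhs_nbhs.
have : forall i, exists p : rat * rat, [/\ ratr p.1 <= x i 0 <= ratr p.2 &
    forall y, ratr p.1 <= y <= ratr p.2 -> P i 0 y].
  move=> i; have /nbhs_ballP[e /= e0 eP] := Px i 0.
  have [q1] : exists q : rat, ratr q \in `]x i 0 - e, x i 0[%R.
    by apply: rat_in_itvoo; rewrite ltrBlDr ltrDl.
  rewrite in_itv/= => /andP[q11 q12].
  have [q2] : exists q : rat, ratr q \in `]x i 0, x i 0 + e[%R.
    by apply: rat_in_itvoo; rewrite ltrDl.
  rewrite in_itv/= => /andP[q21 q22].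
  exists (q1, q2); split => /= [|y /andP[y1 y2]]; first by rewrite !ltW.
  apply: eP; rewrite /ball/= distrC ltr_distl.
  by rewrite (lt_le_trans q11 y1) (le_lt_trans y2 q22).
move=> /choice[p pP].
exists (\col_i (p i).1, \col_i (p i).2).
  move=> y /= yp; apply: PU => i j; rewrite (ord1 j).
  by have [_] := pP i; apply; have := yp i; rewrite !mxE.
by move=> i; rewrite !mxE; have [] := pP i.
Qed.

Lemma measurable_coord (i : 'I_d) :
  measurable_fun setT (fun x : Rd R d => x i 0 : R).
Proof.
apply: (measurability _ (RGenOpens.measurableE R)) => _ [_ [a [b ->] <-]].
rewrite setTI; apply: sub_sigma_algebra.
have /continuousP := @coord_continuous R d 1 i 0.
by apply; exact: interval_open.
Qed.

Lemma measurable_cbox a b : measurable (cbox a b).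
Proof.
rewrite (_ : cbox a b = \bigcap_(i in [set: 'I_d])
    ((fun x : Rd R d => x i 0 : R) @^-1` `[a i 0, b i 0])); last first.
  apply/seteqP; split => x /= h i; first by move=> _; rewrite /= in_itv/= h.
  by have := h i I; rewrite /= in_itv.
apply: fin_bigcap_measurable => // i _.
by rewrite -[X in measurable X]setTI; exact: measurable_coord.
Qed.

Definition cboxes : set (set (Rd R d)) := range (fun p => cbox p.1 p.2).

Lemma measurable_RdE :
  @measurable _ (Rd R d) = <<s cboxes >>.
Proof.
apply/seteqP; split; apply: smallest_sub; first exact: smallest_sigma_algebra.
- move=> U /open_bigcup_rat_cbox ->.
  (* Boxes not contained in [U] are replaced by the empty set, so that the union runs over a whole
     countable type. *)
  rewrite bigcup_mkcond.
  apply: (@countable_bigcupT_measurable _ (g_sigma_algebraType cboxes)) => // p.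
  case: ifPn => _; last exact: (@measurable0 _ (g_sigma_algebraType cboxes)).
  by apply: sub_sigma_algebra; exists (map_mx ratr p.1, map_mx ratr p.2).
- exact: (@sigma_algebra_measurable _ (Rd R d)).
- by move=> _ [p _ <-]; exact: measurable_cbox.
Qed.

(** Take the larger lower and the smaller upper endpoints. The result may be empty, which [cboxes]
    admits because it does not ask for ordered endpoints. *)
Lemma setI_closed_cboxes : setI_closed cboxes.
Proof.
move=> _ _ [p _ <-] [q _ <-].
exists (\col_i Num.max (p.1 i 0) (q.1 i 0), \col_i Num.min (p.2 i 0) (q.2 i 0)) => //.
apply/seteqP; split => [x h|x [h1 h2] i].
  split => i; have := h i; rewrite !mxE ge_max le_min.
    by move=> /andP[/andP[-> _] /andP[-> _]].
  by move=> /andP[/andP[_ ->] /andP[_ ->]].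
by rewrite !mxE ge_max le_min; have /andP[-> ->] := h1 i; have /andP[-> ->] := h2 i.
Qed.

(** Since boxes generate, it is enough to look at preimages of boxes, which are finite intersections
    of coordinate preimages of intervals. *)
Lemma measurable_Rd_fun dT (T : measurableType dT) (f : T -> Rd R d) :
  (forall i, measurable_fun setT (fun t => f t i 0 : R)) ->
  measurable_fun setT f.
Proof.
move=> mf; apply: (measurability _ measurable_RdE) => _ [_ [p _ <-] <-].
rewrite setTI (_ : _ @^-1` _ = \bigcap_(i in [set: 'I_d])
    ((fun t => f t i 0 : R) @^-1` `[p.1 i 0, p.2 i 0])); last first.
  apply/seteqP; split => x /= h i; first by move=> _; rewrite /= in_itv/= h.
  by have := h i I; rewrite /= in_itv.
apply: fin_bigcap_measurable => // i _.
by rewrite -[X in measurable X]setTI; exact: mf.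
Qed.

Definition centered_cbox (n : nat) : set (Rd R d) :=
  cbox (\col_i - n%:R) (\col_i n%:R).

Lemma bigcup_centered_cbox : \bigcup_n centered_cbox n = setT.
Proof.
apply/seteqP; split => // x _.
pose b i := (Num.truncn `|x i 0|).+1.
exists (\max_i b i)%N => // i; rewrite !mxE -ler_norml.
apply: (le_trans (ltW (truncnS_gt _))).
by rewrite ler_nat (leq_bigmax i).
Qed.

Lemma lebesgue_box_cbox_fin (lam : {measure set (Rd R d) -> \bar R}) a b :
  lebesgue_box lam -> (lam (cbox a b) < +oo)%E.
Proof.
move=> hlam; have [ab|] := pselect (forall i, a i 0 <= b i 0).
  by rewrite hlam// ltry.
(* [lebesgue_box] is silent on boxes whose endpoints are out of order; these are empty. *)
move=> nab; rewrite (_ : cbox a b = set0) ?measure0//.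
apply/seteqP; split => // x h; apply: nab => i.
by have /andP[/le_trans] := h i; apply.
Qed.

(** Boxes form a generating pi-system, and the cubes [centered_cbox n] exhaust the space with finite
    measure, so the uniqueness theorem for measures applies. *)
Lemma lebesgue_box_unique (lam nu : {measure set (Rd R d) -> \bar R}) :
  lebesgue_box lam -> lebesgue_box nu ->
  forall A, measurable A -> lam A = nu A.
Proof.
move=> hlam hnu.
apply: (measure_unique cboxes centered_cbox measurable_RdE setI_closed_cboxes).
- by move=> n; exists (\col_i - n%:R, \col_i n%:R).
- exact: bigcup_centered_cbox.
- move=> _ [[a b] _ <-] /=; have [ab|nab] := pselect (forall i, a i 0 <= b i 0).
    by rewrite hlam// hnu.
  rewrite (_ : cbox a b = set0) ?measure0//.
  apply/seteqP; split => // x h; apply: nab => i.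
  by have /andP[/le_trans] := h i; apply.
- by move=> k; exact: lebesgue_box_cbox_fin.
Qed.

End cbox.

(** * Translation invariance and proportionality of translation-invariant measures *)

Section invariance.
Variables (R : realType) (d : nat).
Local Notation T := (Rd R d).

Lemma measurable_affine (Q : 'M[R]_d) (v : 'cV[R]_d) :
  measurable_fun setT ((fun x : 'cV[R]_d => v + Q *m x) : T -> T).
Proof.
apply: measurable_Rd_fun => i.
rewrite (_ : (fun _ => _) =
    (fun t : T => v i 0 + \sum_j Q i j * t j 0)); last first.
  by apply/funext => x; rewrite !mxE.
apply: measurable_funD => //; apply: measurable_sum => j.
by apply: measurable_funM => //; exact: measurable_coord.
Qed.

Lemma measurable_sub : measurable_fun setT (fun z : T * T => (z.2 - z.1 : 'cV[R]_d) : T).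
Proof.
apply: measurable_Rd_fun => i.
rewrite (_ : (fun _ => _) = (fun z : T * T => z.2 i 0 - z.1 i 0)); last first.
  by apply/funext => x; rewrite !mxE.
apply: measurable_funB.
  exact: (measurableT_comp (@measurable_coord R d i) (@measurable_snd _ _ T T)).
exact: (measurableT_comp (@measurable_coord R d i) (@measurable_fst _ _ T T)).
Qed.

Lemma measurable_add : measurable_fun setT (fun z : T * T => (z.1 + z.2 : 'cV[R]_d) : T).
Proof.
apply: measurable_Rd_fun => i.
rewrite (_ : (fun _ => _) = (fun z : T * T => z.1 i 0 + z.2 i 0)); last first.
  by apply/funext => x; rewrite !mxE.
apply: measurable_funD.
  exact: (measurableT_comp (@measurable_coord R d i) (@measurable_fst _ _ T T)).
exact: (measurableT_comp (@measurable_coord R d i) (@measurable_snd _ _ T T)).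
Qed.

Definition translation_invariant (m : set T -> \bar R) :=
  forall (v : 'cV[R]_d) (A : set T), measurable A ->
    m ((fun x : 'cV[R]_d => v + x) @^-1` A) = m A.

Lemma measurable_translation (v : 'cV[R]_d) :
  measurable_fun setT ((fun x : 'cV[R]_d => v + x) : T -> T).
Proof.
rewrite (_ : (fun _ => _) = (fun x : 'cV[R]_d => v + 1%:M *m x)).
  exact: measurable_affine.
by apply/funext => x; rewrite mul1mx.
Qed.

Lemma measurable_opp : measurable_fun setT ((fun x : 'cV[R]_d => - x) : T -> T).
Proof.
rewrite (_ : (fun _ => _) = (fun x : 'cV[R]_d => 0 + (- 1%:M) *m x)).
  exact: measurable_affine.
by apply/funext => x; rewrite add0r mulNmx mul1mx.
Qed.

(** The pushforward by a translation still gives each box its volume: the preimage of the box from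
    [a] to [b] is the box from [a - v] to [b - v]. Uniqueness concludes. *)
Lemma lebesgue_box_translation (lam : {measure set T -> \bar R}) :
  lebesgue_box lam -> translation_invariant lam.
Proof.
move=> hlam v A mA.
apply: (@lebesgue_box_unique _ _ (pushforward lam _) lam) mA => //.
  exact: measurable_translation.
move=> mt a b ab; rewrite /= /pushforward.
rewrite [X in lam X](_ : _ = cbox (a - v) (b - v)).
  rewrite hlam => [|i]; last by rewrite !mxE lerD2r.
  by congr (_%:E); apply: eq_bigr => i _; rewrite !mxE opprB addrA subrK.
by apply/seteqP; split => x /= h i; have := h i;
   rewrite !mxE lerBlDl lerBrDl.
Qed.

Lemma translation_invariant_proportional
    (lam nu : {sigma_finite_measure set T -> \bar R}) (A B : set T) :
  translation_invariant lam -> translation_invariant nu ->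
  measurable A -> measurable B ->
  (nu A * lam B = nu ((fun x : 'cV[R]_d => - x)%R @^-1` B) * lam A)%E.
Proof.
move=> tlam tnu mA mB.
pose nB : set T := (fun x : 'cV[R]_d => - x) @^-1` B.
rewrite -/nB.
have mnB : measurable nB.
  by rewrite -[nB]setTI; exact: measurable_opp.
(* The shear [x |-> x + y], at fixed [y], maps [E2] onto [E1]; integrating
   over [y] first gives the left-hand side from [E1], the right one from [E2]. *)
pose E1 : set (T * T) := [set z | A z.1 /\ B (z.2 - z.1 : 'cV[R]_d)].
pose E2 : set (T * T) := [set z | A (z.1 + z.2 : 'cV[R]_d) /\ nB z.1].
have mE1 : measurable E1.
  rewrite (_ : E1 = (fst @^-1` A) `&`
    ((fun z : T * T => (z.2 - z.1 : 'cV[R]_d) : T) @^-1` B))//.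
  apply: measurableI; rewrite -[X in measurable X]setTI; first exact: measurable_fst.
  exact: measurable_sub.
have mE2 : measurable E2.
  rewrite (_ : E2 = ((fun z : T * T => (z.1 + z.2 : 'cV[R]_d) : T) @^-1` A) `&`
    (fst @^-1` nB))//.
  apply: measurableI; rewrite -[X in measurable X]setTI; last exact: measurable_fst.
  exact: measurable_add.
(* Tonelli for sets: [\x] integrates the measures of x-sections, [\x^] those of y-sections.
   Sigma-finiteness enters here, through uniqueness of the product measure. *)
have prod12 E : measurable E -> ((nu \x lam) E = (nu \x^ lam) E)%E.
  by apply: product_measure_unique => ? ? *; exact: product_measure2E.
(* A set whose x-sections have mass [lam D] over [C] and are null elsewhere has the mass of the
   rectangle with sides [C] and [D]. *)
have sect (C D : set T) (E : set (T * T)) : measurable C -> measurable D ->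
    (forall x, lam (xsection E x) = (\1_C x)%:E * lam D)%E ->
    ((nu \x lam) E = nu C * lam D)%E.
  move=> mC mD h; rewrite /= /product_measure1.
  under eq_integral do rewrite /= h.
  by rewrite ge0_integralZr ?integral_indic ?setIT//; exact: measurableT_comp.
rewrite -(sect A B E1 mA mB); last first.
  move=> x; rewrite indicE; case: (boolP (x \in A)); rewrite ?inE ?notin_setE => Ax.
    rewrite mul1e -(tlam (- x) B mB); congr (lam _); apply/seteqP.
    by split => y; rewrite xsectionE /E1/= [- x + y]addrC => // -[].
  rewrite mul0e (_ : xsection _ _ = set0) ?measure0//.
  by apply/seteqP; split => // y; rewrite xsectionE => -[].
rewrite -(sect nB A E2 mnB mA); last first.
  move=> x; rewrite indicE; case: (boolP (x \in nB)); rewrite ?inE ?notin_setE => Ax.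
    rewrite mul1e -(tlam x A mA); congr (lam _); apply/seteqP.
    by split => y; rewrite xsectionE /E2/= => // -[].
  rewrite mul0e (_ : xsection _ _ = set0) ?measure0//.
  by apply/seteqP; split => // y; rewrite xsectionE => -[].
rewrite !prod12//= /product_measure2; apply: eq_integral => y _ /=.
rewrite -(tnu y); last exact: measurable_ysection.
congr (nu _); apply/seteqP.
by split => x; rewrite !ysectionE /E1 /E2 /nB/= opprD addrA subrr sub0r addrC.
Qed.

End invariance.

(** * Invariance of Lebesgue measure under orthogonal maps *)

Section orthogonal.
Variables (R : realType) (d : nat).
Local Notation T := (Rd R d).

(** Sigma-finiteness becomes a hypothesis instead of a part of the structure, so that the identity
    applies to the pushforward of [lam] by a rotation. *)
Lemma translation_invariant_proportional_measure
    (lam nu : {measure set T -> \bar R}) (A B : set T) :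
  sigma_finite setT lam -> sigma_finite setT nu ->
  translation_invariant lam -> translation_invariant nu ->
  measurable A -> measurable B ->
  (nu A * lam B = nu ((fun x : 'cV[R]_d => - x)%R @^-1` B) * lam A)%E.
Proof.
move=> slam snu tlam tnu mA mB.
pose lam' : {sigma_finite_measure set T -> \bar R} :=
  HB.pack (lam : set T -> \bar R) (Measure.class lam)
    (isSFinite.Build _ _ _ (lam : set T -> \bar R) (sfinite_measure_sigma_finite slam))
    (isSigmaFinite.Build _ _ _ (lam : set T -> \bar R) slam).
pose nu' : {sigma_finite_measure set T -> \bar R} :=
  HB.pack (nu : set T -> \bar R) (Measure.class nu)
    (isSFinite.Build _ _ _ (nu : set T -> \bar R) (sfinite_measure_sigma_finite snu))
    (isSigmaFinite.Build _ _ _ (nu : set T -> \bar R) snu).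
exact: (@translation_invariant_proportional _ _ lam' nu').
Qed.

Lemma sigma_finite_lebesgue_box (lam : {measure set T -> \bar R}) :
  lebesgue_box lam -> sigma_finite setT lam.
Proof.
move=> hlam; exists (@centered_cbox R d); first by rewrite bigcup_centered_cbox.
by move=> n; split; [exact: measurable_cbox|exact: lebesgue_box_cbox_fin].
Qed.

(** The Euclidean ball rather than a cube: the reference set must be preserved by every orthogonal
    map. *)
Definition unit_ball : set T := [set x : T | \sum_i x i 0 ^+ 2 <= 1].

Lemma measurable_unit_ball : measurable unit_ball.
Proof.
rewrite (_ : unit_ball = (fun x : T => \sum_i x i 0 ^+ 2) @^-1` `]-oo, 1]).
  rewrite -[X in measurable X]setTI.
  suff : measurable_fun setT (fun x : T => \sum_i x i 0 ^+ 2 : R) by apply.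
  apply: measurable_sum => i; apply: measurable_funX; exact: measurable_coord.
by apply/seteqP; split => x; rewrite /= in_itv.
Qed.

Lemma unit_ball_mulmx (Q : 'M[R]_d) (x : 'cV[R]_d) : Q *m Q^T = 1%:M ->
  unit_ball (Q *m x) = unit_ball x.
Proof.
move=> /mulmx1C QQ; have sqE (y : 'cV[R]_d) : \sum_i y i 0 ^+ 2 = (y^T *m y) 0 0.
  by rewrite mxE; apply: eq_bigr => i _; rewrite mxE.
by rewrite /unit_ball/= !sqE trmx_mul -mulmxA (mulmxA Q^T) QQ mul1mx.
Qed.

Lemma unit_ball_opp (x : 'cV[R]_d) : unit_ball (- x) = unit_ball x.
Proof. by rewrite /unit_ball/=; under eq_bigr do rewrite mxE sqrrN. Qed.

(** The ball lies between two cubes of positive finite volume, with half-sides [r] and 1. *)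
Lemma lebesgue_box_unit_ball (lam : {measure set T -> \bar R}) :
  lebesgue_box lam -> (0 < lam unit_ball < +oo)%E.
Proof.
move=> hlam; apply/andP; split; last first.
  apply: (@le_lt_trans _ _ (lam (cbox (\col_i -1) (\col_i 1)))); last first.
    exact: lebesgue_box_cbox_fin.
  apply: le_measure; rewrite ?inE.
  - exact: measurable_unit_ball.
  - exact: measurable_cbox.
  move=> x xB i; rewrite !mxE -ler_norml -(@expr_le1 _ 2)//.
  rewrite real_normK ?num_real//; apply: le_trans xB.
  by rewrite (bigD1 i)//= lerDl sumr_ge0// => j _; exact: sqr_ge0.
(* As [r <= 1], the squares of the coordinates in the small cube sum to at most [d * r <= 1]. Using
   [d.+1] keeps [r] positive when [d] is 0. *)
pose r : R := d.+1%:R^-1.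
have r0 : 0 < r by rewrite invr_gt0 ltr0n.
apply: (@lt_le_trans _ _ (lam (cbox (\col_i - r) (\col_i r)))).
  rewrite hlam => [|i]; last by rewrite !mxE ge0_cp// ltW.
  by rewrite lte_fin prodr_gt0// => i _; rewrite !mxE opprK addr_gt0.
apply: le_measure; rewrite ?inE.
- exact: measurable_cbox.
- exact: measurable_unit_ball.
move=> x xB; rewrite /unit_ball/=.
apply: (@le_trans _ _ (\sum_(i < d) r)).
  apply: ler_sum => i _; have := xB i; rewrite !mxE -ler_norml => xr.
  rewrite -real_normK ?num_real//.
  apply: (@le_trans _ _ (r ^+ 2)); first by rewrite lerXn2r// ?nnegrE// ltW.
  rewrite expr2; apply: ler_piMl; first exact: ltW.
  by rewrite /r invf_le1 ?ltr0n// ler1n.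
rewrite sumr_const card_ord -[r *+ d]mulr_natl ler_pdivrMr ?ltr0n// mul1r ler_nat.
exact: leqnSn.
Qed.

Lemma measurable_mulmx (Q : 'M[R]_d) :
  measurable_fun setT ((fun x : 'cV[R]_d => Q *m x) : T -> T).
Proof.
rewrite (_ : (fun _ => _) = (fun x : 'cV[R]_d => 0 + Q *m x)).
  exact: measurable_affine.
by apply/funext => x; rewrite add0r.
Qed.

Lemma lebesgue_box_orthogonal (lam : {measure set T -> \bar R}) (Q : 'M[R]_d)
    (A : set T) : lebesgue_box lam -> Q *m Q^T = 1%:M -> measurable A ->
  lam ((fun x : 'cV[R]_d => Q *m x) @^-1` A) = lam A.
Proof.
move=> hlam QQ mA.
have mQ (P : 'M[R]_d) (C : set T) : measurable C ->
    measurable ((fun x : 'cV[R]_d => P *m x : T) @^-1` C : set T).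
  by move=> mC; rewrite -[X in measurable X]setTI; exact: measurable_mulmx.
have /andP[B0 Boo] := lebesgue_box_unit_ball hlam.
have tlam := lebesgue_box_translation hlam.
have slam := sigma_finite_lebesgue_box hlam.
pose phi : T -> T := fun x : 'cV[R]_d => Q *m x.
have E : (lam (phi @^-1` A) * lam unit_ball =
    lam (phi @^-1` ((fun x : 'cV[R]_d => - x)%R @^-1` unit_ball)) * lam A)%E.
  apply: (@translation_invariant_proportional_measure lam (pushforward lam phi)
    A unit_ball slam _ tlam _ mA measurable_unit_ball).
  - exact: measurable_mulmx.
  - move=> mphi.
    (* Rotated cubes exhaust the space; pulling them back by [phi] undoes the rotation and leaves
       cubes of finite measure. *)
    exists (fun n => (fun x : 'cV[R]_d => Q^T *m x) @^-1` @centered_cbox R d n).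
      by rewrite -preimage_bigcup bigcup_centered_cbox preimage_setT.
    move=> n; split; first by apply: (mQ Q^T); exact: measurable_cbox.
    rewrite [X in (X < _)%E](_ : _ = lam (@centered_cbox R d n)).
      exact: lebesgue_box_cbox_fin.
    congr (lam _); apply/funext => x /=.
    by rewrite /phi mulmxA (mulmx1C QQ) mul1mx.
  - move=> mphi v C mC.
   
    (* Translating the pushforward by [v] amounts to translating [lam] by [Q^T *m v], since [Q]
       sends that vector to [v]. *)
    rewrite -[RHS](tlam (Q^T *m v) (phi @^-1` C) (mQ Q C mC)).
    rewrite /= /pushforward. congr (lam _). apply/funext => x /=.
    by rewrite /phi mulmxDr mulmxA QQ mul1mx.
have -> : lam ((fun x : 'cV[R]_d => Q *m x) @^-1` A) = lam (phi @^-1` A) by [].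
(* The ball is preserved by [Q] and by negation, so both sides of [E] carry the factor
   [lam unit_ball], which is positive and finite and cancels. *)
move: E; rewrite [X in (_ = lam X * _)%E -> _](_ : _ = unit_ball); last first.
  by apply/funext => x /=; rewrite /phi unit_ball_opp unit_ball_mulmx.
rewrite muleC => E.
have Bfin : lam unit_ball \is a fin_num by rewrite ge0_fin_numE.
by apply/le_anti/andP; split; rewrite -(lee_pmul2l Bfin B0) E.
Qed.

Lemma lebesgue_box_isometry (lam : {measure set T -> \bar R}) (v : 'cV[R]_d)
    (Q : 'M[R]_d) (A : set T) :
  lebesgue_box lam -> Q *m Q^T = 1%:M -> measurable A ->
  lam ((fun x : 'cV[R]_d => v + Q *m x) @^-1` A) = lam A.
Proof.
move=> hlam QQ mA.
rewrite -[RHS](lebesgue_box_translation hlam v mA).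
rewrite -[RHS](lebesgue_box_orthogonal hlam QQ)//.
by rewrite -[X in measurable X]setTI; exact: measurable_translation.
Qed.

End orthogonal.

(** * Change of variables along measure-preserving maps, and linear combinations of integrals *)

Section integration.
Variables (R : realType).

(** Change of variables for the nonnegative function [|f|]. This comes first because the signed
    version requires [f \o phi] to be integrable. *)
Lemma measure_preserving_integrable d1 d2 (X : measurableType d1)
    (Y : measurableType d2) (m1 : {measure set X -> \bar R})
    (m2 : {measure set Y -> \bar R}) (phi : X -> Y) (f : Y -> \bar R) :
  measurable_fun setT phi ->
  (forall A, measurable A -> m1 (phi @^-1` A) = m2 A) ->
  m2.-integrable setT f -> m1.-integrable setT (f \o phi).
Proof.
move=> mphi m12 /integrableP[mf foo]; apply/integrableP; split.
  exact: measurableT_comp.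
have mabs : measurable_fun setT (fun y => `|f y|)%E by exact: measurableT_comp.
have := @ge0_integral_pushforward _ _ _ _ _ _ mphi m1 setT (fun y => `|f y|)%E
  measurableT mabs.
rewrite preimage_setT => <- //.
by rewrite (eq_measure_integral m2)// => A mA _; exact: m12.
Qed.

Lemma measure_preserving_integral d1 d2 (X : measurableType d1)
    (Y : measurableType d2) (m1 : {measure set X -> \bar R})
    (m2 : {measure set Y -> \bar R}) (phi : X -> Y) (f : Y -> \bar R) :
  measurable_fun setT phi ->
  (forall A, measurable A -> m1 (phi @^-1` A) = m2 A) ->
  m2.-integrable setT f ->
  (\int[m1]_x f (phi x) = \int[m2]_y f y)%E.
Proof.
move=> mphi m12 fi; have [mf _] := integrableP _ _ _ fi.
have fphi := measure_preserving_integrable mphi m12 fi.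
have := @integral_pushforward _ _ _ _ _ _ mphi m1 setT f mf.
rewrite preimage_setT => <- //.
by rewrite (eq_measure_integral m2)// => A mA _; exact: m12.
Qed.

(** Moves a constant matrix out of a vector integral, one row [s] at a time. *)
Lemma Rintegral_sumZl dT (T : measurableType dT) (m : {measure set T -> \bar R})
    n (s : 'I_n -> R) (f : 'I_n -> T -> R) :
  (forall j, m.-integrable setT (fun t => (f j t)%:E)) ->
  m.-integrable setT (fun t => (\sum_j s j * f j t)%:E) /\
  \int[m]_t (\sum_j s j * f j t) = \sum_j s j * \int[m]_t f j t.
Proof.
move=> fi.
have sfi j : m.-integrable setT (fun t => (s j * f j t)%:E).
  by under eq_fun do rewrite EFinM; exact: integrableZl.
split.
  by under eq_fun do rewrite -sumEFin; exact: integrable_sum.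
rewrite /Rintegral; under eq_integral do rewrite -sumEFin.
rewrite integral_sum// (eq_bigr (fun j => (s j * \int[m]_t f j t)%:E)) ?sumEFin//.
move=> j _; rewrite -RintegralZl//; last exact: fi.
by rewrite /Rintegral fineK//; exact: integrable_fin_num.
Qed.

End integration.

(** * Pointwise form of the lifted integrand *)

Section lifted_integrand.
Variables (R : realType) (d c c' : nat) (H : set 'M[R]_d).
Hypothesis hH : closed_subgroup_Od H.
Variables (rho : 'M[R]_d -> 'M[R]_c) (sigma : 'M[R]_d -> 'M[R]_c').
Hypothesis hrho : representation H rho.
Variable k : 'cV[R]_d -> 'cV[R]_c -> 'cV[R]_c -> 'M[R]_(c', c).
Hypothesis hk : forall h y u v, H h ->
  k (h *m y) (rho h *m u) (rho h *m v) = sigma h *m k y u v *m invmx (rho h).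
Variable F : 'cV[R]_d * 'M[R]_d -> 'cV[R]_c.
Hypothesis hF : induced_rep H rho F.

(** Factor [(x, h)] as [sG x] times [(0, h)]. *)
Lemma induced_rep_sink x h : H h -> F (x, h) = rho (invmx h) *m sink_down F x.
Proof.
move=> Hh; have [_ H1 _ _ _] := hH.
by rewrite -(hF (g := sG x))// /gmul /sG/= mulmx0 addr0 mul1mx.
Qed.

(** With [g = (x, a)], both feature arguments of [k] become [rho (invmx a)] applied to values of
    [sink_down F], so steerability at [invmx a] pulls out [sigma (invmx a)]. *)
Lemma omega_hat_lift g p : H g.2 -> H p.2 ->
  omega_hat rho k (ltrans g F) p =
  sigma (invmx g.2) *m psi_integrand k (sink_down F) g.1 (g.1 + g.2 *m p.1).
Proof.
case: g p => [x a] [y h] /= Ha Hh; have [_ H1 HM HV HO] := hH.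
have [rho1 rhoM] := hrho.
have uO b : H b -> b \in unitmx by move=> /HO /mulmx1_unit[].
(* The factor [rho h] built into [kappa] removes the dependence on [h], because [h] times the
   inverse of [a *m h] is the inverse of [a]. *)
have rhoh w : rho h *m (rho (invmx (a *m h)) *m w) = rho (invmx a) *m w :> 'cV_c.
  rewrite mulmxA; congr (_ *m w).
  rewrite -rhoM//; last exact/HV/HM.
  rewrite -{1}(mulKmx (uO _ Ha) h) -mulmxA mulmxV ?mulmx1//.
  exact/uO/HM.
(* Steerability leaves an [invmx] of this matrix on the right; it cancels only once invertibility is
   known, the inverse being [rho a]. *)
have urho : rho (invmx a) \in unitmx.
  by have [] := @mulmx1_unit _ _ (rho a) (rho (invmx a));
     rewrite -?rhoM ?mulmxV ?uO//; apply: HV.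
rewrite /omega_hat /kappa /ltrans /piG /hG /gmul /gunit/= mulmx0 addr0 mulmx1.
rewrite -mulmxA !induced_rep_sink//; last exact: HM.
rewrite !rhoh /psi_integrand [x + _]addrC addrK [_ + x]addrC.
(* Write [y] as [invmx a *m (a *m y)] to match the first argument of [k] in [hk]. *)
rewrite -{1}(mulKmx (uO _ Ha) y) hk; last exact: HV.
by rewrite -!mulmxA (mulKmx urho).
Qed.

End lifted_integrand.

Theorem mainTheorem10 (R : realType) (d c c' : nat)
  (H : set 'M[R]_d) (hH : closed_subgroup_Od H)
  (lam : {measure set (Rd R d) -> \bar R}) (hlam : lebesgue_box lam)
  (mu : probability (Md R d) R) (hmu : normalized_haar H mu)
  (rho : 'M[R]_d -> 'M[R]_c) (hrho : representation H rho)
  (sigma : 'M[R]_d -> 'M[R]_c') (hsigma : representation H sigma)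
  (k : 'cV[R]_d -> 'cV[R]_c -> 'cV[R]_c -> 'M[R]_(c', c))
  (hk : forall h y u v, H h ->
     k (h *m y) (rho h *m u) (rho h *m v) = sigma h *m k y u v *m invmx (rho h))
  (F : 'cV[R]_d * 'M[R]_d -> 'cV[R]_c) (hF : induced_rep H rho F)
  (g : 'cV[R]_d * 'M[R]_d) (hg : Gset H g)
  (hint1 : vintegrable (lam \x mu)%E (Gset H : set (Rd R d * Md R d))
             (omega_hat rho k (ltrans g F)))
  (hint2 : vintegrable lam setT (psi_integrand k (sink_down F) (piG g))) :
  vint (lam \x mu)%E (Gset H : set (Rd R d * Md R d)) (omega_hat rho k (ltrans g F))
  = lift_up sigma (Psi lam k (sink_down F)) g.
Proof.
have [cH _ _ _ HO] := hH; have [_ muH _] := hmu.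
have mH : measurable (H : set (Md R d)).
  rewrite -[H]setCK; apply: measurableC; apply: sub_sigma_algebra.
  exact: closed_openC.
have GE : (Gset H : set (Rd R d * Md R d)) = setT `*` H.
  by apply/seteqP; split => [p|p []].
have mG : measurable (Gset H : set (Rd R d * Md R d)) by rewrite GE; exact: measurableX.
(* [mu] lives on all matrices but is concentrated on [H]. The product with the possibly infinite
   [lam setT] vanishes since infinity times 0 is 0. *)
have G0 : (lam \x mu)%E (~` (Gset H : set (Rd R d * Md R d))) = 0%E.
  rewrite (_ : ~` _ = setT `*` ~` H); last by apply/seteqP; split => [p|p []].
  rewrite [LHS]product_measure1E//; last exact: measurableC.
  by rewrite -[RHS](mule0 (lam setT)); congr (_ * _)%E; exact: muH.
pose phi (p : Rd R d * Md R d) : Rd R d := g.1 + g.2 *m (p.1 : 'cV[R]_d).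
have mphi : measurable_fun setT phi.
  exact: (measurableT_comp (measurable_affine g.2 g.1)
    (@measurable_fst _ _ (Rd R d) (Md R d))).
(* [phi] ignores the matrix coordinate, whose total mass is 1, and acts on the vector coordinate by
   an isometry. *)
have phi_preserving A : measurable A -> (lam \x mu)%E (phi @^-1` A) = lam A.
  move=> mA; pose B : set (Rd R d) := (fun x : 'cV[R]_d => g.1 + g.2 *m x) @^-1` A.
  have mB : measurable B.
    by rewrite -[B]setTI; exact: (measurable_affine g.2 g.1).
  rewrite (_ : phi @^-1` A = B `*` setT); last first.
    by apply/seteqP; split => [p|p []].
  have -> : (lam \x mu)%E (B `*` setT) = lam B.
    rewrite [LHS]product_measure1E// -[RHS]mule1; congr (_ * _)%E.
    exact: probability_setT.
  exact: (lebesgue_box_isometry g.1 hlam (HO _ hg) mA).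
apply/colP => i; rewrite !mxE.
pose P := psi_integrand k (sink_down F) g.1.
pose f (y : Rd R d) := \sum_j sigma (invmx g.2) i j * P y j 0.
have [fi fE] := Rintegral_sumZl (sigma (invmx g.2) i) hint2.
transitivity (\int[(lam \x mu)%E]_(p in Gset H : set (Rd R d * Md R d)) f (phi p)).
  apply: eq_Rintegral => p; rewrite inE => Hp.
  by rewrite (omega_hat_lift hH hrho hk hF)// mxE.
transitivity (\int[lam]_y f y).
  have := measure_preserving_integrable mphi phi_preserving fi.
  have := measure_preserving_integral mphi phi_preserving fi.
  rewrite /Rintegral => <- phii; congr fine.
  (* The change of variables takes place on the whole product; deleting the null complement
     restricts the integral to [Gset H]. *)
  rewrite (negligible_integral _ _ phii G0)//; last exact: measurableC.
  by rewrite setTD setCK.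
by rewrite fE; apply: eq_bigr => j _; rewrite mxE.
Qed.
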